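(* Let $\mathfrak{g}, \mathfrak{h}$ be two Leibniz algebras and let $\mathfrak{h}$ be a Leibniz $\mathfrak{g}$-representation, with left and right actions $\rho^L,\rho^R$. Then the triple $\big(\oplus_{n \geq 1} \mathrm{Hom}(\mathfrak{h}^{\otimes n}, \mathfrak{g}), \llbracket ~, ~ \rrbracket, d\big)$ (with $\mathrm{Hom}(\mathfrak{h}^{\otimes n}, \mathfrak{g})$ in degree $n$, and with the bracket and differential defined in the context) is a differential graded Lie algebra. Moreover, a linear map $T : \mathfrak{h} \rightarrow \mathfrak{g}$ is a $\lambda$-weighted relative Rota-Baxter operator if and only if $T$ is a Maurer-Cartan element in this differential graded Lie algebra, i.e. $dT + \frac{1}{2}\llbracket T, T \rrbracket = 0$.
   Context: All vector spaces, (multi)linear maps and tensor products are over a field $\mathbf{k}$ of characteristic $0$, and $\lambda \in \mathbf{k}$ is a fixed scalar. A (left) Leibniz algebra is a vector space $\mathfrak{g}$ with a bilinear bracket $[~,~]_\mathfrak{g}$ satisfying $[x,[y,z]_\mathfrak{g}]_\mathfrak{g} = [[x,y]_\mathfrak{g},z]_\mathfrak{g} + [y,[x,z]_\mathfrak{g}]_\mathfrak{g}$ for all $x,y,z$. A representation of $\mathfrak{g}$ is a vector space $V$ with bilinear maps $\rho^L : \mathfrak{g}\otimes V \to V$, $\rho^R : V \otimes \mathfrak{g} \to V$ such that for $x,y\in\mathfrak{g}$, $v \in V$: $\rho^L(x,\rho^L(y,v)) = \rho^L([x,y]_\mathfrak{g},v) + \rho^L(y,\rho^L(x,v))$; $\rho^L(x,\rho^R(v,y))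 = \rho^R(\rho^L(x,v),y) + \rho^R(v,[x,y]_\mathfrak{g})$; $\rho^R(v,[x,y]_\mathfrak{g}) = \rho^R(\rho^R(v,x),y) + \rho^L(x,\rho^R(v,y))$. A Leibniz algebra $\mathfrak{h}$ is a Leibniz $\mathfrak{g}$-representation if it has maps $\rho^L,\rho^R$ making it a representation of $\mathfrak{g}$ and, for $u,v\in\mathfrak{h}$, $x\in\mathfrak{g}$: $[u,\rho^R(v,x)]_\mathfrak{h} = \rho^R([u,v]_\mathfrak{h},x) + [v,\rho^R(u,x)]_\mathfrak{h}$; $[u,\rho^L(x,v)]_\mathfrak{h} = [\rho^R(u,x),v]_\mathfrak{h} + \rho^L(x,[u,v]_\mathfrak{h})$; $\rho^L(x,[u,v]_\mathfrak{h}) = [\rho^L(x,u),v]_\mathfrak{h} + [u,\rho^L(x,v)]_\mathfrak{h}$. A linear map $T:\mathfrak{h}\to\mathfrak{g}$ is a $\lambda$-weighted relative Rota-Baxter operator if $[Tu,Tv]_\mathfrak{g} = T(\rho^L(Tu,v)+\rho^R(u,Tv)+\lambda[u,v]_\mathfrak{h})$ for all $u,v\in\mathfrak{h}$. Balavoine's bracket: for a vector space $V$, on $\oplus_{n\ge 0}\mathrm{Hom}(V^{\otimes n+1},V)$ (with $\mathrm{Hom}(V^{\otimes n+1},V)$ in degree $n$) one has the graded Lie bracket $$[f,g]_B = \sum_{i=1}^{m+1}(-1)^{(i-1)n} f\circ_i g - (-1)^{mn}\sum_{i=1}^{n+1}(-1)^{(i-1)m} g\circ_i f,$$ $$(f\circ_i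 g)(x_1,\ldots,x_{m+n+1}) = \sum_{\sigma\in Sh(i-1,n)}(-1)^\sigma f\big(x_{\sigma(1)},\ldots,x_{\sigma(i-1)}, g(x_{\sigma(i)},\ldots,x_{\sigma(i+n-1)},x_{i+n}),x_{i+n+1},\ldots,x_{m+n+1}\big)$$ for $f\in\mathrm{Hom}(V^{\otimes m+1},V)$, $g\in\mathrm{Hom}(V^{\otimes n+1},V)$, where $Sh(p,q)$ is the set of $(p,q)$-shuffles and $(-1)^\sigma$ is the sign of $\sigma$. Bracket and differential: take $V=\mathfrak{g}\oplus\mathfrak{h}$ and $\theta,\theta'\in\mathrm{Hom}(V^{\otimes 2},V)$ given by $\theta((x,u),(y,v)) = ([x,y]_\mathfrak{g},\ \rho^L(x,v)+\rho^R(u,y))$ and $\theta'((x,u),(y,v)) = (0,\ -\lambda[u,v]_\mathfrak{h})$. Regard $\mathrm{Hom}(\mathfrak{h}^{\otimes n},\mathfrak{g})$ as a subspace of $\mathrm{Hom}(V^{\otimes n},V)$ (precompose with the projection $V\to\mathfrak{h}$, postcompose with the inclusion $\mathfrak{g}\to V$). For $P\in\mathrm{Hom}(\mathfrak{h}^{\otimes m},\mathfrak{g})$, $Q\in\mathrm{Hom}(\mathfrak{h}^{\otimes n},\mathfrak{g})$ set $$\llbracket P,Q\rrbracket = (-1)^m[[\theta,P]_B,Q]_B \in \mathrm{Hom}(\mathfrak{h}^{\otimes m+n},\mathfrak{g}).$$ The map $d$ is the restriction of $[\theta',-]_B$; explicitly, for $P\in\mathrm{Hom}(\mathfrak{h}^{\otimes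 n},\mathfrak{g})$, $$(dP)(u_1,\ldots,u_{n+1}) = (-1)^n\sum_{1\le i<j\le n+1}(-1)^i P(u_1,\ldots,\widehat{u_i},\ldots,u_{j-1},\lambda[u_i,u_j]_\mathfrak{h},u_{j+1},\ldots,u_{n+1}).$$ *)

(* Defs.v *)
From HB Require Import structures.
From mathcomp Require Import all_boot all_order all_fingroup all_algebra.
From mathcomp Require Import boolp functions.

Set Implicit Arguments.
Unset Strict Implicit.
Unset Printing Implicit Defensive.

Import GRing.Theory.
Local Open Scope ring_scope.

(* Elements of Hom(V^{(x) n}, W), as n-ary multilinear maps. *)
Section MultilinearMaps.
Variables (k : fieldType) (n : nat) (V W : lmodType k).

Definition multilinear (f : ('I_n -> V) -> W) : Prop :=
  forall (i : 'I_n) (x : 'I_n -> V), linear (fun v => f [eta x with i |-> v]).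

Definition multilinear_pred : {pred (('I_n -> V) -> W)} :=
  [pred f | `[< multilinear f >]].

Record mhom := MHom {
  mhom_fun :> ('I_n -> V) -> W;
  _ : mhom_fun \in multilinear_pred }.

Lemma multilinear_submod_closed : submod_closed multilinear_pred.
Proof.
split; first by apply/asboolP => i x a u v /=; rewrite scaler0 addr0.
move=> a f1 f2 /asboolP Hf1 /asboolP Hf2; apply/asboolP => i x b u v /=.
rewrite !fctE Hf1 Hf2 !scalerDr !scalerA [b * a]mulrC !addrA.
by congr (_ + _); rewrite -!addrA; congr (_ + _); rewrite addrC.
Qed.

HB.instance Definition _ := GRing.isSubmodClosed.Build k _ multilinear_pred
  multilinear_submod_closed.

HB.instance Definition _ := [isSub for mhom_fun].
HB.instance Definition _ := [Choice of mhom by <:].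
HB.instance Definition _ := [SubChoice_isSubLmodule of mhom by <:].

Lemma mhomP (f : mhom) : multilinear f.
Proof. by case: f => f /= /asboolP. Qed.

Definition mk_mhom (f : ('I_n -> V) -> W) (Hf : multilinear f) : mhom :=
  MHom (asboolT Hf).

Lemma mhom_ext (f g : mhom) : (forall x, f x = g x) -> f = g.
Proof. by move=> E; apply: val_inj; apply: funext. Qed.

End MultilinearMaps.

Arguments mhom {k} n V W.

Section SmallArity.
Variables (k : fieldType) (V W : lmodType k).

Lemma mhom1_subproof (T : {linear V -> W}) :
  multilinear (fun x : 'I_1 -> V => T (x ord0)).
Proof. by move=> i x a u v; rewrite [i]ord1 /= linearP. Qed.

Definition mhom1 (T : {linear V -> W}) : mhom 1 V W :=
  mk_mhom (mhom1_subproof T).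

Lemma mhom2_subproof (b : V -> V -> W) : bilinear_for *:%R *:%R b ->
  multilinear (fun x : 'I_2 -> V => b (x ord0) (x ord_max)).
Proof.
move=> Hb i x a u v /=.
have [->|->] : i = ord0 \/ i = ord_max.
- by case: i => [[|[|j]] Hj] //; [left | right]; apply: val_inj.
- exact: (Hb.1 (x ord_max)).
- exact: (Hb.2 (x ord0)).
Qed.

Definition mhom2 (b : V -> V -> W) (Hb : bilinear_for *:%R *:%R b) :
  mhom 2 V W := mk_mhom (mhom2_subproof Hb).

End SmallArity.

Section Leibniz.
Variable k : fieldType.

Definition leibniz_algebra (g : lmodType k) (br : {bilinear g -> g -> g}) :
    Prop :=
  forall x y z, br x (br y z) = br (br x y) z + br y (br x z).

Record leibniz_representation (g h : lmodType k)
    (brg : {bilinear g -> g -> g})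
    (rhoL : {bilinear g -> h -> h}) (rhoR : {bilinear h -> g -> h}) : Prop := {
  rep_LL : forall x y v,
    rhoL x (rhoL y v) = rhoL (brg x y) v + rhoL y (rhoL x v);
  rep_LR : forall x y v,
    rhoL x (rhoR v y) = rhoR (rhoL x v) y + rhoR v (brg x y);
  rep_RR : forall x y v,
    rhoR v (brg x y) = rhoR (rhoR v x) y + rhoL x (rhoR v y) }.

Record leibniz_alg_representation (g h : lmodType k)
    (brg : {bilinear g -> g -> g}) (brh : {bilinear h -> h -> h})
    (rhoL : {bilinear g -> h -> h}) (rhoR : {bilinear h -> g -> h}) : Prop := {
  alg_rep_rep : leibniz_representation brg rhoL rhoR;
  alg_rep_R : forall u v x,
    brh u (rhoR v x) = rhoR (brh u v) x + brh v (rhoR u x);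
  alg_rep_RL : forall u v x,
    brh u (rhoL x v) = brh (rhoR u x) v + rhoL x (brh u v);
  alg_rep_L : forall u v x,
    rhoL x (brh u v) = brh (rhoL x u) v + brh u (rhoL x v) }.

Definition relative_rota_baxter (g h : lmodType k)
    (brg : {bilinear g -> g -> g}) (brh : {bilinear h -> h -> h})
    (rhoL : {bilinear g -> h -> h}) (rhoR : {bilinear h -> g -> h})
    (lam : k) (T : {linear h -> g}) : Prop :=
  forall u v, brg (T u) (T v) =
    T (rhoL (T u) v + rhoR u (T v) + lam *: brh u v).

End Leibniz.

(* Transport between components of a graded object whose indices are provably,
   but not definitionally, equal. *)
Definition deg_cast (L : nat -> Type) (m n : nat) (e : m = n) (x : L m) : L n :=
  eq_rect m L x n e.
Arguments deg_cast L {m n} e x.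

Section Balavoine.
Variables (k : fieldType) (V : lmodType k).

(* Sh(p, q), seen inside 'S_N for N >= p + q as the permutations which fix
   every index >= p + q; this does not affect signs. *)
Definition shuffle (N p q : nat) (s : 'S_N) : bool :=
  [&& [forall a : 'I_N, forall b : 'I_N, (a < b < p)%N ==> (s a < s b)%N],
      [forall a : 'I_N, forall b : 'I_N,
         [&& p <= a, a < b & b < p + q]%N ==> (s a < s b)%N]
    & [forall a : 'I_N, (p + q <= a)%N ==> (s a == a)]].

(* f (y_0, .., y_(i-1), g (y_i, .., y_(i+n)), y_(i+n+1), .., y_(m+n)) *)
Definition insertion (m n : nat) (f : mhom m.+1 V V) (g : mhom n.+1 V V)
    (i : 'I_m.+1) (y : 'I_(m + n).+1 -> V) : V :=
  f (fun j : 'I_m.+1 =>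
       if (j < i)%N then y (inord j)
       else if j == i then g (fun l : 'I_n.+1 => y (inord (i + l)))
       else y (inord (j + n))).

(* Slots are numbered from 0, so this is f o_(i+1) g in the usual 1-based
   numbering, and the shuffles range over Sh(i, n). *)
Definition circ_fun (m n : nat) (f : mhom m.+1 V V) (g : mhom n.+1 V V)
    (i : 'I_m.+1) (x : 'I_(m + n).+1 -> V) : V :=
  \sum_(s : 'S_(m + n).+1 | shuffle i n s)
     (-1) ^+ s *: insertion f g i (x \o s).

Lemma insertion_multilinear m n (f : mhom m.+1 V V) (g : mhom n.+1 V V) i :
  multilinear (@insertion m n f g i).
Proof.
move=> p x a u v; rewrite /insertion.
have Em (q : nat) (Hq : (q < (m + n).+1)%N) : (inord q == p) = (q == p :> nat).
  by rewrite -val_eqE /= inordK.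
have ltp : (p <= m + n)%N by rewrite -ltnS.
have lei : (i <= m)%N by rewrite -ltnS.
case: (ltnP p i) => [lt_pi|le_ip].
  have Hp : (p < m.+1)%N by apply: ltn_trans lt_pi _.
  pose q : 'I_m.+1 := Ordinal Hp.
  pose z w : 'I_m.+1 -> V := [eta (fun j : 'I_m.+1 =>
       if (j < i)%N then x (inord j)
       else if j == i then g (fun l : 'I_n.+1 => x (inord (i + l)))
       else x (inord (j + n))) with q |-> w].
  suff E w : (fun j : 'I_m.+1 =>
       if (j < i)%N then [eta x with p |-> w] (inord j)
       else if j == i
         then g (fun l : 'I_n.+1 => [eta x with p |-> w] (inord (i + l)))
       else [eta x with p |-> w] (inord (j + n))) = z w.
    by rewrite !E; exact: mhomP.
  apply: funext => j; rewrite /z /= -[j == q]val_eqE /=.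
  have ltj : (j <= m)%N by rewrite -ltnS.
  case: ltnP => [lt_ji|le_ij].
    by rewrite Em // ltnS (leq_trans ltj) ?leq_addr.
  have /negPf -> : (j != p :> nat) by rewrite neq_ltn (leq_trans lt_pi le_ij) orbT.
  case: eqP => [_|_].
    congr (mhom_fun g _); apply: funext => l.
    have ltl : (l <= n)%N by rewrite -ltnS.
    rewrite Em ?ltnS ?leq_add //.
    by rewrite gtn_eqF // (leq_trans lt_pi) // leq_addr.
  rewrite Em ?ltnS ?leq_add2r //.
  by rewrite gtn_eqF // (leq_trans lt_pi) // (leq_trans le_ij) // leq_addr.
case: (leqP p (i + n)) => [le_pin|lt_inp].
  have Hp : (p - i < n.+1)%N by rewrite ltnS leq_subLR.
  pose q : 'I_n.+1 := Ordinal Hp.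
  pose z w : 'I_m.+1 -> V := [eta (fun j : 'I_m.+1 =>
       if (j < i)%N then x (inord j) else x (inord (j + n))) with
       i |-> g [eta (fun l : 'I_n.+1 => x (inord (i + l))) with q |-> w]].
  suff E w : (fun j : 'I_m.+1 =>
       if (j < i)%N then [eta x with p |-> w] (inord j)
       else if j == i
         then g (fun l : 'I_n.+1 => [eta x with p |-> w] (inord (i + l)))
       else [eta x with p |-> w] (inord (j + n))) = z w.
    by rewrite !E /z mhomP; exact: mhomP.
  apply: funext => j; rewrite /z /=.
  have ltj : (j <= m)%N by rewrite -ltnS.
  case: ltnP => [lt_ji|le_ij].
    rewrite Em ?ltnS ?(leq_trans ltj) ?leq_addr //.
    by rewrite -val_eqE /= !ltn_eqF // (leq_trans lt_ji).
  case: (eqVneq j i) => [_|ne_ji].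
    congr (mhom_fun g _); apply: funext => l /=.
    have ltl : (l <= n)%N by rewrite -ltnS.
    rewrite Em ?ltnS ?leq_add // -[l == q]val_eqE /=.
    by rewrite -(eqn_add2l i l) subnKC.
  rewrite Em ?ltnS ?leq_add2r //.
  have lt_ij : (i < j)%N by rewrite ltn_neqAle le_ij andbT eq_sym.
  by rewrite gtn_eqF // (leq_ltn_trans le_pin) // ltn_add2r.
have Hp : (p - n < m.+1)%N by rewrite ltnS leq_subLR (addnC n m).
have le_np : (n <= p)%N by rewrite (leq_trans (leq_addl i n)) // ltnW.
pose q : 'I_m.+1 := Ordinal Hp.
pose z w : 'I_m.+1 -> V := [eta (fun j : 'I_m.+1 =>
     if (j < i)%N then x (inord j)
     else if j == i then g (fun l : 'I_n.+1 => x (inord (i + l)))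
     else x (inord (j + n))) with q |-> w].
suff E w : (fun j : 'I_m.+1 =>
     if (j < i)%N then [eta x with p |-> w] (inord j)
     else if j == i
       then g (fun l : 'I_n.+1 => [eta x with p |-> w] (inord (i + l)))
     else [eta x with p |-> w] (inord (j + n))) = z w.
  by rewrite !E; exact: mhomP.
apply: funext => j; rewrite /z /= -[j == q]val_eqE /= -(eqn_add2r n j) subnK //.
have ltj : (j <= m)%N by rewrite -ltnS.
case: ltnP => [lt_ji|le_ij].
  rewrite Em ?ltnS ?(leq_trans ltj) ?leq_addr //.
  rewrite !ltn_eqF //.
    by rewrite (leq_ltn_trans _ lt_inp) // leq_add2r ltnW.
  by rewrite (leq_trans lt_ji).
case: (eqVneq j i) => [->|ne_ji].
  rewrite ltn_eqF //.
  congr (mhom_fun g _); apply: funext => l /=.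
  have ltl : (l <= n)%N by rewrite -ltnS.
  rewrite Em ?ltnS ?leq_add // ltn_eqF //.
  by rewrite (leq_ltn_trans _ lt_inp) // leq_add2l.
by rewrite Em ?ltnS ?leq_add2r.
Qed.

Lemma circ_subproof m n (f : mhom m.+1 V V) (g : mhom n.+1 V V) i :
  multilinear (@circ_fun m n f g i).
Proof.
move=> p x a u v; rewrite /circ_fun scaler_sumr -big_split /=.
apply: eq_bigr => s _.
have E w : [eta x with p |-> w] \o s = [eta (x \o s) with (s^-1)%g p |-> w].
  by apply: funext => j /=; rewrite (canF_eq (permK s)).
by rewrite !E insertion_multilinear scalerDr !scalerA [a * _]mulrC.
Qed.

Definition circ (m n : nat) (f : mhom m.+1 V V) (g : mhom n.+1 V V)
  (i : 'I_m.+1) : mhom (m + n).+1 V V := mk_mhom (circ_subproof f g i).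

Definition balavoine (m n : nat) (f : mhom m.+1 V V) (g : mhom n.+1 V V) :
    mhom (m + n).+1 V V :=
  \sum_(i < m.+1) (-1) ^+ (i * n) *: circ f g i
  - (-1) ^+ (m * n) *:
      deg_cast (fun r => mhom r.+1 V V) (addnC n m)
        (\sum_(i < n.+1) (-1) ^+ (i * m) *: circ g f i).

End Balavoine.

Section DGLA.
Variable k : fieldType.

Lemma deg_skewE m n : ((n + m).+1 = (m + n).+1)%N.
Proof. by rewrite addnC. Qed.

Lemma deg_assocE m n p : (((m + n).+1 + p).+1 = (m + (n + p).+1).+1)%N.
Proof. by rewrite addSn addnS addnA. Qed.

Lemma deg_leftcommE m n p : ((n + (m + p).+1).+1 = (m + (n + p).+1).+1)%N.
Proof. by rewrite !addnS addnCA. Qed.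

Lemma deg_derlE m n : ((m.+1 + n).+1 = (m + n).+2)%N.
Proof. by rewrite addSn. Qed.

Lemma deg_derrE m n : ((m + n.+1).+1 = (m + n).+2)%N.
Proof. by rewrite addnS. Qed.

(* Differential graded Lie algebras concentrated in degrees >= 1: the component
   of degree n + 1 is L n.  Hence a bracket adding degrees maps L m and L n to
   L (m + n).+1, and the Koszul signs involve m.+1 and n.+1.  The base field
   has characteristic 0 where this is used, so that graded skew-symmetry
   needs no supplement. *)
Record is_dgla (L : nat -> lmodType k)
    (br : forall m n, L m -> L n -> L (m + n).+1)
    (d : forall n, L n -> L n.+1) : Prop := {
  dgla_bilinear : forall m n, bilinear_for *:%R *:%R (br m n);
  dgla_linear : forall n, linear (d n);
  dgla_skew : forall m n (x : L m) (y : L n),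
    br m n x y =
      - ((-1) ^+ (m.+1 * n.+1) *: deg_cast L (deg_skewE m n) (br n m y x));
  dgla_jacobi : forall m n p (x : L m) (y : L n) (z : L p),
    br m (n + p).+1 x (br n p y z) =
      deg_cast L (deg_assocE m n p) (br (m + n).+1 p (br m n x y) z)
      + (-1) ^+ (m.+1 * n.+1) *:
          deg_cast L (deg_leftcommE m n p) (br n (m + p).+1 y (br m p x z));
  dgla_square0 : forall n (x : L n), d n.+1 (d n x) = 0;
  dgla_derivation : forall m n (x : L m) (y : L n),
    d (m + n).+1 (br m n x y) =
      deg_cast L (deg_derlE m n) (br m.+1 n (d m x) y)
      + (-1) ^+ m.+1 *: deg_cast L (deg_derrE m n) (br m n.+1 x (d n y)) }.

Definition maurer_cartan (L : nat -> lmodType k)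
    (br : forall m n, L m -> L n -> L (m + n).+1)
    (d : forall n, L n -> L n.+1) (T : L 0%N) : Prop :=
  d 0%N T + 2^-1 *: br 0%N 0%N T T = 0.

End DGLA.

Section DerivedBracket.
Variables (k : fieldType) (g h : lmodType k).

Section Embedding.
Variable n : nat.

(* Hom(h^{(x) n}, g) as a subspace of Hom((g + h)^{(x) n}, g + h). *)
Lemma embed_subproof (P : mhom n h g) :
  multilinear (fun x : 'I_n -> (g * h)%type =>
    (P (fun j => (x j).2), 0) : (g * h)%type).
Proof.
move=> i x a u v.
have E w : (fun j => ([eta x with i |-> w] j).2) =
    [eta (fun j => (x j).2) with i |-> w.2].
  by apply: funext => j /=; case: eqP.
rewrite !E mhomP.
by apply: injective_projections => //=; rewrite scaler0 addr0.
Qed.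

Definition embed (P : mhom n h g) : mhom n (g * h)%type (g * h)%type :=
  mk_mhom (embed_subproof P).

(* The left inverse of [embed] which restricts to h and projects to g. *)
Lemma unembed_subproof (f : mhom n (g * h)%type (g * h)%type) :
  multilinear (fun u : 'I_n -> h => (f (fun j => (0, u j))).1).
Proof.
move=> i x a u v.
have E w : (fun j => (0, [eta x with i |-> w] j) : (g * h)%type) =
    [eta (fun j => (0, x j)) with i |-> (0, w)].
  by apply: funext => j /=; case: eqP.
rewrite !E.
have -> : (0, a *: u + v) = a *: (0, u) + (0, v) :> (g * h)%type.
  by apply: injective_projections => //=; rewrite scaler0 addr0.
by rewrite mhomP.
Qed.

Definition unembed (f : mhom n (g * h)%type (g * h)%type) : mhom n h g :=
  mk_mhom (unembed_subproof f).

Lemma embedK : cancel embed unembed.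
Proof. by move=> P; apply: mhom_ext. Qed.

End Embedding.

Variables (brg : {bilinear g -> g -> g}) (brh : {bilinear h -> h -> h}).
Variables (rhoL : {bilinear g -> h -> h}) (rhoR : {bilinear h -> g -> h}).
Variable lam : k.

Definition theta_fun (a b : (g * h)%type) : (g * h)%type :=
  (brg a.1 b.1, rhoL a.1 b.2 + rhoR a.2 b.1).

Lemma theta_subproof : bilinear_for *:%R *:%R theta_fun.
Proof.
split=> [b c a a'|a c b b']; apply: injective_projections => /=;
  rewrite ?linearPl ?linearPr // scalerDr addrACA //.
Qed.

Definition theta : mhom 2 (g * h)%type (g * h)%type := mhom2 theta_subproof.

Definition theta'_fun (a b : (g * h)%type) : (g * h)%type :=
  (0, - (lam *: brh a.2 b.2)).

Lemma theta'_subproof : bilinear_for *:%R *:%R theta'_fun.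
Proof.
split=> [b c a a'|a c b b']; apply: injective_projections => /=;
  rewrite ?linearPl ?linearPr ?scaler0 ?addr0 //.
all: by rewrite scalerDr opprD scalerN !scalerA mulrC.
Qed.

Definition theta' : mhom 2 (g * h)%type (g * h)%type := mhom2 theta'_subproof.

(* (-1)^|P| [[theta, P]_B, Q]_B, where P : mhom m.+1 h g has degree m.+1. *)
Definition derived_full (m n : nat) (P : mhom m.+1 h g) (Q : mhom n.+1 h g) :
    mhom (m + n).+2 (g * h)%type (g * h)%type :=
  (-1) ^+ m.+1 *:
    @balavoine _ _ m.+1 n (@balavoine _ _ 1 m theta (embed P)) (embed Q).

Definition diff_full (n : nat) (P : mhom n.+1 h g) :
    mhom n.+2 (g * h)%type (g * h)%type :=
  @balavoine _ _ 1 n theta' (embed P).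

(* As [unembed] retracts Hom((g + h)^{(x) n}, g + h) onto the image of [embed],
   these are the restrictions of the operations above once the image of
   [embed] is known to be stable. *)
Definition derived_bracket (m n : nat) (P : mhom m.+1 h g)
    (Q : mhom n.+1 h g) : mhom (m + n).+2 h g :=
  unembed (derived_full P Q).

Definition derived_diff (n : nat) (P : mhom n.+1 h g) : mhom n.+2 h g :=
  unembed (diff_full P).

End DerivedBracket.

Definition mhom_pos (k : fieldType) (g h : lmodType k) (n : nat) : lmodType k :=
  mhom n.+1 h g.

(* Main.v *)
Require Import Defs.
From HB Require Import structures.
From mathcomp Require Import all_boot all_order all_fingroup all_algebra.
From mathcomp Require Import boolp functions ring zify.

Set Implicit Arguments.
Unset Strict Implicit.
Unset Printing Implicit Defensive.

Import GRing.Theory.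
Local Open Scope ring_scope.

(** Let V = g + h. Balavoine's bracket makes the multilinear operations on V a
    graded Lie algebra in which the hypotheses are quadratic equations:
    [theta, theta] = 0 is the Leibniz identity of g and the three axioms of the
    action on h, [theta', theta'] = 0 the Leibniz identity of h times lam^2, and
    [theta', theta] = 0 the compatibility of the action with the bracket of h
    times lam. The operations coming from Hom(h^n, g) commute with one another.
    Hence D = [theta, -] and [theta', -] are anticommuting derivations of square
    zero, and the axioms of a differential graded Lie algebra for (-1)^m [D P, Q]
    and [theta', -] are those of a derived bracket: skew-symmetry is D applied
    to [P, Q] = 0, the Jacobi identity is that of the bracket for D P, D Q, R,
    with D [D P, Q] = +- [D P, D Q], and [theta', -] is a derivation because it
    anticommutes with D ([derived_skew], [derived_jacobi], [derived_derivation]).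

    The main work is the graded Jacobi identity of Balavoine's bracket. It
    follows from the pre-Lie identity of f o g = sum_i +- f o_i g. Write i_x f
    for f with first argument x. In a shuffle the first argument comes first
    either among those given to f before g, or among those given to g, so that
      i_x (f o g) = (-1)^n (i_x f) o g + f o (i_x g),   n the degree of g.
    This also holds for n = 0, where i_x g is a vector v, if f o v means i_v f.
    The recursion determines f o g. It is the definition of [plug], and the
    pre-Lie identity [plug_prelie] is then an induction on the number of
    arguments, both sides of it obeying the same recursion;
    [plug_shuffle_sum] shows that [plug] is the alternating sum over shuffles.
    Operations are functions on lists here, which makes the casts between equal
    degrees disappear; [to_list_balavoine] transfers the result.

    Finally Hom(h^n, g) has to be stable. Give an operation on V weight w if it
    is homogeneous with w = number of arguments in g - number of values in g.
    Weights add up under the bracket, theta has weight 1, theta' weight 0,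
    and Hom(h^n, g) is the space of operations of weight -1. So the derived
    bracket has weight 1 - 1 - 1 = -1, the differential 0 - 1 = -1, and
    [P, Q] = 0, as no operation has weight -2.

    For the last assertion, [[theta, T], T] evaluated at two elements of h is
    twice [T u, T v] - T (rhoL (T u) v + rhoR u (T v)). *)

(** * Linear combinations *)

Lemma sqr_sign1 (k : fieldType) n : (-1) ^+ n * (-1) ^+ n = 1 :> k.
Proof. by rewrite -exprMn mulrNN mulr1 expr1n. Qed.

Section LinearCombinations.
Variables (k : fieldType) (V : lmodType k).

(** Syntax of linear combinations, so that identities with signs between
    elements of a module can be reduced to identities between scalars, which
    commutative ring normalization decides. *)
Inductive lin_expr :=
  | LVar of nat | LZero | LAdd of lin_expr & lin_expr | LOpp of lin_expr
  | LScale of k & lin_expr.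

Fixpoint lin_eval (vs : seq V) e : V :=
  match e with
  | LVar i => nth 0 vs i
  | LZero => 0
  | LAdd e1 e2 => lin_eval vs e1 + lin_eval vs e2
  | LOpp e1 => - lin_eval vs e1
  | LScale c e1 => c *: lin_eval vs e1
  end.

Fixpoint lin_coef e (i : nat) : k :=
  match e with
  | LVar j => if i == j then 1 else 0
  | LZero => 0
  | LAdd e1 e2 => lin_coef e1 i + lin_coef e2 i
  | LOpp e1 => - lin_coef e1 i
  | LScale c e1 => c * lin_coef e1 i
  end.

Lemma lin_evalE vs e :
  lin_eval vs e = \sum_(i < size vs) lin_coef e i *: nth 0 vs i.
Proof.
elim: e => [j||e1 IH1 e2 IH2|e1 IH1|c e1 IH1] /=.
- have [ltj|lej] := ltnP j (size vs).
    rewrite (bigD1 (Ordinal ltj)) //= eqxx scale1r big1 ?addr0 // => i ne_ij.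
    by rewrite -val_eqE /= in ne_ij; rewrite (negPf ne_ij) scale0r.
  rewrite nth_default // big1 // => i _.
  by rewrite ltn_eqF ?scale0r // (leq_trans (ltn_ord i)).
- by rewrite big1 // => i _; rewrite scale0r.
- by rewrite IH1 IH2 -big_split; apply: eq_bigr => i _; rewrite scalerDl.
- by rewrite IH1 -sumrN; apply: eq_bigr => i _; rewrite scaleNr.
- by rewrite IH1 scaler_sumr; apply: eq_bigr => i _; rewrite scalerA.
Qed.

Fixpoint lin_same n e1 e2 : Prop :=
  if n is n'.+1 then lin_coef e1 n' = lin_coef e2 n' /\ lin_same n' e1 e2
  else True.

Lemma lin_eval_same vs e1 e2 :
  lin_same (size vs) e1 e2 -> lin_eval vs e1 = lin_eval vs e2.
Proof.
rewrite !lin_evalE => E; apply: eq_bigr => i _; congr (_ *: _).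
elim: (size vs) (nat_of_ord i) (ltn_ord i) E => // n IHn j.
by rewrite ltnS leq_eqVlt => /predU1P[-> []//|/IHn IH [_ /IH]].
Qed.

End LinearCombinations.

Ltac lin_mem v vs :=
  lazymatch vs with
  | nil => constr:(false)
  | v :: _ => constr:(true)
  | _ :: ?vs' => lin_mem v vs'
  end.

Ltac lin_index v vs :=
  lazymatch vs with
  | v :: _ => constr:(0%N)
  | _ :: ?vs' => let i := lin_index v vs' in constr:(i.+1)
  end.

Ltac lin_atoms e vs :=
  lazymatch e with
  | @GRing.zero _ => vs
  | @GRing.add _ ?e1 ?e2 => let vs1 := lin_atoms e1 vs in lin_atoms e2 vs1
  | @GRing.opp _ ?e1 => lin_atoms e1 vs
  | @GRing.scale _ _ _ ?e1 => lin_atoms e1 vs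
  | ?v => lazymatch lin_mem v vs with true => vs | false => constr:(v :: vs) end
  end.

Ltac lin_quote k vs e :=
  lazymatch e with
  | @GRing.zero _ => constr:(@LZero k)
  | @GRing.add _ ?e1 ?e2 =>
      let q1 := lin_quote k vs e1 in
      let q2 := lin_quote k vs e2 in constr:(LAdd q1 q2)
  | @GRing.opp _ ?e1 => let q1 := lin_quote k vs e1 in constr:(LOpp q1)
  | @GRing.scale _ _ ?c ?e1 =>
      let q1 := lin_quote k vs e1 in constr:(@LScale k c q1)
  | ?v => let i := lin_index v vs in constr:(@LVar k i)
  end.

(** Atoms are compared syntactically, so an atom that occurs on both sides has
    to occur there in the same form. *)
Ltac lin_coefs k V :=
  lazymatch goal with
  | |- ?a = ?b =>
      let vs0 := lin_atoms a (@nil V) in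
      let vs := lin_atoms b vs0 in
      let qa := lin_quote k vs a in
      let qb := lin_quote k vs b in
      (* the conclusion of the lemma unfolds to the goal *)
      refine (@lin_eval_same k V vs qa qb _); rewrite /=; do ?[split => //]
  end.

(** * The total composition and its pre-Lie identity *)

Section Plugging.
Variables (k : fieldType) (V : lmodType k).
Implicit Types (f g h : seq V -> V) (s : seq V).

Definition fix1 f (x : V) : seq V -> V := fun s => f (x :: s).

(** The total composition f o g = sum_i (-1)^(i (a - 1)) f o_i g for a map g of
    arity a, by the place of the first argument x. It either stays with f, and
    g is inserted later, or becomes the first argument of g, whose degree a - 1
    drops by one. Once g has received all its arguments, its value is the next
    argument of f. The arity of f is the one that makes the total number of
    arguments right. *)
Fixpoint plug (a : nat) f g s : V :=
  if a isn't a'.+1 then f (g [::] :: s)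
  else if s isn't x :: s' then 0
  else (-1) ^+ a' *: plug a (fix1 f x) g s' + plug a' f (fix1 g x) s'.

Lemma plug0 f g : plug 0 f g = fix1 f (g [::]).
Proof. by apply: funext => -[]. Qed.

Definition list_multilinear f : Prop :=
  forall s1 s2 (c : k) (u v : V),
    f (s1 ++ (c *: u + v) :: s2) = c *: f (s1 ++ u :: s2) + f (s1 ++ v :: s2).

Lemma fix1_multilinear f x : list_multilinear f -> list_multilinear (fix1 f x).
Proof. by move=> Hf s1; apply: (Hf (x :: s1)). Qed.

Lemma plug_linearl a c f f' g s :
  plug a (c *: f + f') g s = c *: plug a f g s + plug a f' g s.
Proof.
elim: s a f f' g => [|x s IHs] [|a] f f' g //=; first by rewrite scaler0 addr0.
rewrite IHs -[fix1 _ x]/(c *: fix1 f x + fix1 f' x) IHs.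
lin_coefs k V; ring.
Qed.

Lemma plug_linearr a f c g g' s : list_multilinear f ->
  plug a f (c *: g + g') s = c *: plug a f g s + plug a f g' s.
Proof.
elim: s a f g g' => [|x s IHs] [|a] f g g' Hf /=; try exact: (Hf [::]).
  by rewrite scaler0 addr0.
rewrite (IHs a.+1); last exact: fix1_multilinear.
rewrite -[fix1 (_ + _) x]/(c *: fix1 g x + fix1 g' x) IHs //.
lin_coefs k V; ring.
Qed.

Lemma plug_multilinear a f g :
  list_multilinear f -> list_multilinear g -> list_multilinear (plug a f g).
Proof.
move=> Hf Hg s1 s2 c u v.
elim: s1 a f g Hf Hg => [|x s1 IHs] [|a] f g Hf Hg /=.
- exact: (Hf [:: g [::]]).
- have E w : list_multilinear w ->
      fix1 w (c *: u + v) = c *: fix1 w u + fix1 w v.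
    by move=> Hw; apply: funext => s; apply: (Hw [::]).
  rewrite !E // plug_linearl plug_linearr //.
  lin_coefs k V; ring.
- exact: (Hf [:: g [::], x & s1]).
- rewrite !IHs //; try exact: fix1_multilinear.
  lin_coefs k V; ring.
Qed.

Lemma plug_small a f g s : (size s < a)%N -> plug a f g s = 0.
Proof.
elim: s a f g => [|x s IHs] [|a] f g //= lt_sa.
rewrite (IHs a) // IHs ?scaler0 ?addr0 //.
by rewrite (leq_trans (ltnW lt_sa)).
Qed.

(** The map g is evaluated once it has collected a arguments. *)
Lemma plug_eqr a f g g' s : (forall t, size t = a -> g t = g' t) ->
  plug a f g s = plug a f g' s.
Proof.
elim: s a f g g' => [|x s IHs] [|a] f g g' E //=; try by rewrite E.
rewrite (IHs _ _ g g') // (IHs _ _ (fix1 g x) (fix1 g' x)) // => t Et.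
by apply: E; rewrite /= Et.
Qed.

Lemma plug0r a f s : list_multilinear f -> plug a f 0 s = 0.
Proof.
move=> Hf; have /eqP := plug_linearr a 1 0 0 s Hf.
by rewrite !scale1r addr0 -subr_eq0 opprD addNKr oppr_eq0 => /eqP.
Qed.

(** Stands for v o h = 0 when v is a vector: with g of arity 0, there is no
    argument in which h could be inserted. *)
Lemma plug_plug_small a f g h s : list_multilinear f ->
  plug a f (plug a.+1 g h) s = 0.
Proof.
move=> Hf; rewrite (@plug_eqr _ _ _ 0) ?plug0r // => t Et.
by rewrite plug_small ?Et.
Qed.

(** The pre-Lie identity when g is a vector, i.e. of degree -1. It is the
    recursion for the first argument v of f o h, and the place where the
    recursion and the composition with a vector meet. *)
Lemma plug_prelie_value b f g h s : list_multilinear f ->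
  plug b.+1 (plug 0 f g) h s =
  (-1) ^+ b *: (plug 0 (plug b.+1 f h) g s - plug b f (plug 0 h g) s).
Proof.
move=> Hf.
rewrite !plug0 [fix1 (plug _ _ _) _ s]/=.
by rewrite addrK scalerA sqr_sign1 scale1r.
Qed.

(** Let B(f, g, h) be the difference of the two sides. Fixing the first argument
    is a graded derivation of the composition, hence
      i_x B(f, g, h) = +- B(i_x f, g, h) +- B(f, i_x g, h) +- B(f, g, i_x h),
    and all three terms vanish by induction, or by [plug_prelie_value] if a map
    of arity one has become a vector. *)
Lemma plug_prelie b c f g h s : list_multilinear f ->
  plug c.+1 (plug b.+1 f g) h s - plug (b + c).+1 f (plug c.+1 g h) s =
  (-1) ^+ (b * c) *:
    (plug b.+1 (plug c.+1 f h) g s - plug (c + b).+1 f (plug b.+1 h g) s).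
Proof.
elim: s b c f g h => [|x s IHs] b c f g h Hf; first by rewrite !subr0 scaler0.
have Hfx := fix1_multilinear x Hf.
have fixE a f1 g1 : fix1 (plug a.+1 f1 g1) x =
    (-1) ^+ a *: plug a.+1 (fix1 f1 x) g1 + plug a f1 (fix1 g1 x) by [].
have step a f1 g1 : plug a.+1 f1 g1 (x :: s) =
   (-1) ^+ a *: plug a.+1 (fix1 f1 x) g1 s + plug a f1 (fix1 g1 x) s by [].
rewrite !step !fixE !plug_linearl !plug_linearr //.
(* B(i_x f, g, h) = 0 *)
have /eqP := IHs b c (fix1 f x) g h Hfx.
rewrite subr_eq => /eqP ->.
(* B(f, i_x g, h) = 0 *)
have -> : plug c.+1 (plug b f (fix1 g x)) h s =
    plug (b + c) f (plug c.+1 (fix1 g x) h) s +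
    (-1) ^+ (b * c + c) *:
      (plug b (plug c.+1 f h) (fix1 g x) s -
       plug (c + b) f (plug b h (fix1 g x)) s).
  case: b => [|b].
    rewrite plug_prelie_value // mul0n add0n plug_plug_small // add0r addn0 //.
  have /eqP := IHs b c f (fix1 g x) h Hf.
  rewrite subr_eq addrC addnS => /eqP ->.
  by rewrite mulSn addnAC exprD exprD sqr_sign1 mul1r.
(* B(f, g, i_x h) = 0 *)
have -> : plug b.+1 (plug c f (fix1 h x)) g s =
    plug (c + b) f (plug b.+1 (fix1 h x) g) s +
    (-1) ^+ (b * c + b) *:
      (plug c (plug b.+1 f g) (fix1 h x) s -
       plug (b + c) f (plug c g (fix1 h x)) s).
  case: c => [|c].
    rewrite plug_prelie_value // muln0 add0n plug_plug_small // add0r addn0 //.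
  have /eqP := IHs c b f (fix1 h x) g Hf.
  rewrite subr_eq addrC addnS => /eqP ->.
  by rewrite mulnS addnAC exprD exprD sqr_sign1 mul1r mulnC.
have Hb := sqr_sign1 k b; have Hc := sqr_sign1 k c.
have Hbc := sqr_sign1 k (b * c).
rewrite !exprD.
lin_coefs k V; ring: Hb Hc Hbc.
Qed.

End Plugging.

(** * The graded Lie bracket *)

Section Cochains.
Variables (k : fieldType) (V : lmodType k).

Definition list_multilinear_pred : {pred (seq V -> V)} :=
  [pred f | `[< list_multilinear f >]].

Lemma list_multilinear_submod_closed : submod_closed list_multilinear_pred.
Proof.
split; first by apply/asboolP => s1 s2 c u v; rewrite /= scaler0 addr0.
move=> a f g /asboolP Hf /asboolP Hg; apply/asboolP => s1 s2 c u v.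
rewrite !fctE Hf Hg; lin_coefs k V; ring.
Qed.

HB.instance Definition _ := GRing.isSubmodClosed.Build k _ list_multilinear_pred
  list_multilinear_submod_closed.

(** Operations of all degrees at once: degrees are indices of the operations
    below, not of the type, so that no casts are needed. *)
Record cochain := Cochain {
  cochain_fun :> seq V -> V;
  _ : cochain_fun \in list_multilinear_pred }.

HB.instance Definition _ := [isSub for cochain_fun].
HB.instance Definition _ := [Choice of cochain by <:].
HB.instance Definition _ := [SubChoice_isSubLmodule of cochain by <:].

Lemma cochainP (f : cochain) : list_multilinear f.
Proof. by case: f => f /= /asboolP. Qed.

Definition mk_cochain f (Hf : list_multilinear f) : cochain :=
  Cochain (asboolT Hf).

Lemma cochain_ext (f g : cochain) : (forall s, f s = g s) -> f = g.
Proof. by move=> E; apply: val_inj; apply: funext. Qed.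

Definition pre (n : nat) (f g : cochain) : cochain :=
  mk_cochain (plug_multilinear n.+1 (cochainP f) (cochainP g)).

Lemma pre_bilinear n : bilinear_for *:%R *:%R (pre n).
Proof.
split=> [g c f f'|f c g g']; apply: cochain_ext => s.
  exact: plug_linearl.
exact: plug_linearr (cochainP f).
Qed.

HB.instance Definition _ n := bilinear_isBilinear.Build k cochain cochain
  cochain *:%R *:%R (pre n) (pre_bilinear n).

Lemma prelie n p (f g h : cochain) :
  pre p (pre n f g) h - pre (n + p) f (pre p g h) =
  (-1) ^+ (n * p) *: (pre n (pre p f h) g - pre (p + n) f (pre n h g)).
Proof. by apply: cochain_ext => s; apply: plug_prelie (cochainP f). Qed.

Definition lie (m n : nat) (f g : cochain) : cochain :=
  pre n f g - (-1) ^+ (m * n) *: pre m g f.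

Lemma lie_bilinear m n : bilinear_for *:%R *:%R (lie m n).
Proof.
split=> [g c f f'|f c g g']; rewrite /lie ?linearPl ?linearPr /=;
  lin_coefs k cochain; ring.
Qed.

HB.instance Definition _ m n := bilinear_isBilinear.Build k cochain cochain
  cochain *:%R *:%R (lie m n) (lie_bilinear m n).

Lemma lie_skew m n f g : lie m n f g = - ((-1) ^+ (m * n) *: lie n m g f).
Proof.
rewrite /lie [(n * m)%N]mulnC.
have Hmn := sqr_sign1 k (m * n).
lin_coefs k cochain; ring: Hmn.
Qed.

(** The commutator of a pre-Lie product is a Lie bracket. The pre-Lie identities
    with f, g, h as the left factor are solved for the terms f (g h), g (f h)
    and h (f g); what remains cancels. *)
Lemma lie_jacobi m n p f g h :
  lie m (n + p) f (lie n p g h) =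
  lie (m + n) p (lie m n f g) h
  + (-1) ^+ (m * n) *: lie n (m + p) g (lie m p f h).
Proof.
rewrite /lie.
rewrite !(linearDl, linearDr, linearNl, linearNr, linearZl_LR, linearZr_LR) /=.
have /eqP := prelie n p f g h; rewrite subr_eq => /eqP ->.
have /eqP := prelie m p g f h; rewrite subr_eq => /eqP ->.
have /eqP := prelie m n h f g; rewrite subr_eq => /eqP ->.
rewrite ![(n + m)%N]addnC ![(p + m)%N]addnC ![(p + n)%N]addnC.
rewrite !mulnDl !mulnDr !exprD ![(n * m)%N]mulnC.
have Hmn := sqr_sign1 k (m * n); have Hmp := sqr_sign1 k (m * p).
have Hnp := sqr_sign1 k (n * p).
lin_coefs k cochain; ring: Hnp Hmp Hmn.
Qed.

End Cochains.

(** * Derived brackets *)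

Lemma double_eq0 (k : fieldType) (V : lmodType k) (v : V) :
  2 != 0 :> k -> v = - v -> v = 0.
Proof.
move=> nz2 /eqP; rewrite -addr_eq0 -mulr2n -scaler_nat scaler_eq0 (negPf nz2).
by move/eqP.
Qed.

Section DerivedBracketTheory.
Variables (k : fieldType) (C : lmodType k).
Variable br : nat -> nat -> {bilinear C -> C -> C}.
Hypothesis br_skew : forall m n x y,
  br m n x y = - ((-1) ^+ (m * n) *: br n m y x).
Hypothesis br_jacobi : forall m n p x y z,
  br m (n + p) x (br n p y z) =
  br (m + n) p (br m n x y) z + (-1) ^+ (m * n) *: br n (m + p) y (br m p x z).
Hypothesis nz2 : 2 != 0 :> k.

Lemma ad1_leibniz t m n x y :
  br 1 (m + n) t (br m n x y) =
  br m.+1 n (br 1 m t x) y + (-1) ^+ m *: br m n.+1 x (br 1 n t y).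
Proof. by rewrite br_jacobi !add1n mul1n. Qed.

(** [t, [t', x]] + [t', [t, x]] = [[t, t'], x] for t and t' of degree 1; with
    t = t', the square of [t, -] is half of [[t, t], -]. *)
Lemma ad1_anticomm t t' n x : br 1 1 t t' = 0 ->
  br 1 n.+1 t (br 1 n t' x) = - br 1 n.+1 t' (br 1 n t x).
Proof.
by move=> Htt'; rewrite -[n.+1]add1n ad1_leibniz Htt' linear0l add0r scaleN1r.
Qed.

Lemma ad1_square0 t n x : br 1 1 t t = 0 -> br 1 n.+1 t (br 1 n t x) = 0.
Proof. by move=> Htt; apply: double_eq0 => //; apply: ad1_anticomm. Qed.

Variable t : C.
Hypothesis Htt : br 1 1 t t = 0.

Definition derived m n x y := (-1) ^+ m.+1 *: br m.+1 n (br 1 m t x) y.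

(** Expand [t, [x, y]] = 0 and exchange the factors of [x, [t, y]]. *)
Lemma derived_skew m n x y : br m n x y = 0 ->
  derived m n x y = - ((-1) ^+ (m.+1 * n.+1) *: derived n m y x).
Proof.
move=> Hxy; have := ad1_leibniz t m n x y; rewrite Hxy linear0r.
move/eqP; rewrite eq_sym addr_eq0 => /eqP E.
rewrite /derived E [br m n.+1 _ _]br_skew.
rewrite mulSn !mulnS !exprD !exprS.
have Hm := sqr_sign1 k m; have Hn := sqr_sign1 k n.
have Hmn := sqr_sign1 k (m * n).
lin_coefs k C; ring: Hm Hn Hmn.
Qed.

(** The Jacobi identity for [t, x], [t, y] and z, in which
    [[t, x], [t, y]] = +- [t, [[t, x], y]] because [t, -] has square zero. *)
Lemma derived_jacobi m n p x y z :
  derived m (n + p).+1 x (derived n p y z) =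
  derived (m + n).+1 p (derived m n x y) z
  + (-1) ^+ (m.+1 * n.+1) *: derived n (m + p).+1 y (derived m p x z).
Proof.
rewrite /derived !linearZr_LR /= !linearZl_LR /=.
rewrite -[(n + p).+1]addSn br_jacobi -[(m + n).+1]addSn ad1_leibniz.
rewrite ad1_square0 // linear0l add0r linearZl_LR /= !addSn !addnS.
rewrite mulSn !mulnS !(exprD, exprS).
have Hm := sqr_sign1 k m; have Hn := sqr_sign1 k n.
have Hmn := sqr_sign1 k (m * n).
lin_coefs k C; ring: Hm Hn Hmn.
Qed.

Variable d : C.
Hypothesis Hdt : br 1 1 d t = 0.

Lemma derived_derivation m n x y :
  br 1 (m + n).+1 d (derived m n x y) =
  derived m.+1 n (br 1 m d x) y
  + (-1) ^+ m.+1 *: derived m n.+1 x (br 1 n d y).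
Proof.
rewrite /derived linearZr_LR /= -[(m + n).+1]addSn ad1_leibniz.
rewrite (ad1_anticomm _ _ Hdt) linearNl !exprS.
lin_coefs k C; ring.
Qed.

End DerivedBracketTheory.

(** * Shuffles by the place of the first argument *)

Section Shuffles.

Lemma shuffleP N p q (s : 'S_N) :
  reflect [/\ forall a b : 'I_N, (a < b < p)%N -> (s a < s b)%N,
              forall a b : 'I_N, (p <= a)%N -> (a < b)%N -> (b < p + q)%N ->
                (s a < s b)%N
            & forall a : 'I_N, (p + q <= a)%N -> s a = a]
          (shuffle p q s).
Proof.
apply: (iffP and3P) => -[H1 H2 H3]; split.
- by move=> a b Hab; move/forallP/(_ a)/forallP/(_ b)/implyP: H1; apply.
- move=> a b Hpa Hab Hb; move/forallP/(_ a)/forallP/(_ b)/implyP: H2; apply.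
  exact/and3P.
- by move=> a Ha; move/forallP/(_ a)/implyP: H3 => /(_ Ha)/eqP.
- by apply/forallP => a; apply/forallP => b; apply/implyP; apply: H1.
- apply/forallP => a; apply/forallP => b; apply/implyP => /and3P[].
  exact: H2.
- by apply/forallP => a; apply/implyP => Ha; rewrite H3.
Qed.

Lemma shuffle00 N (s : 'S_N) : shuffle 0 0 s = (s == 1%g).
Proof.
apply/shuffleP/eqP => [[_ _ Hs]|->].
  by apply/permP => a; rewrite perm1 Hs.
by split=> [a b|a b|a _]; rewrite ?perm1 ?ltn0 ?andbF.
Qed.

(** A shuffle is increasing on each block, so the least index opens one of the
    two blocks, which is then nonempty. *)
Lemma shuffle_min N i n (s : 'S_N.+1) j : shuffle i n s -> (0 < i + n)%N ->
  s j = ord0 -> (j = 0 :> nat /\ (0 < i)%N) \/ (j = i :> nat /\ (0 < n)%N).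
Proof.
move=> /shuffleP[H1 H2 H3] Hin Hj.
have [le_j|lt_j] := leqP (i + n) j.
  by have := H3 j le_j; rewrite Hj => E; move: le_j; rewrite -E /=; lia.
have [lt_ji|le_ij] := ltnP j i.
  left; split; last by lia.
  have [//|gt0] := posnP j.
  by have := H1 ord0 j; rewrite gt0 lt_ji Hj => /(_ isT).
right; split; last by lia.
have lt_iN : (i < N.+1)%N by apply: leq_ltn_trans (ltn_ord j).
move: le_ij; rewrite leq_eqVlt => /predU1P[//|lt_ij].
by have := H2 (Ordinal lt_iN) j; rewrite Hj => /(_ (leqnn i) lt_ij lt_j).
Qed.

(** The least index occurs at the start of a block, so inserting it there or
    removing it does not affect whether the blocks are increasing. The first
    block is treated here, the second one in [shuffle_lift_snd]. *)
Lemma shuffle_lift_fst N i n (s : 'S_N) :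
  shuffle i.+1 n (lift_perm ord0 ord0 s) = shuffle i n s.
Proof.
apply/shuffleP/shuffleP => -[H1 H2 H3]; split.
- move=> a b Hab; have := H1 (lift ord0 a) (lift ord0 b).
  by rewrite !lift_perm_lift !lift0; apply.
- move=> a b Ha Hab Hb; have := H2 (lift ord0 a) (lift ord0 b).
  by rewrite !lift_perm_lift !lift0; apply.
- move=> a Ha; apply: (@lift_inj _ ord0); rewrite -(lift_perm_lift ord0).
  by apply: H3; rewrite lift0.
- move=> a b; case: (unliftP ord0 a) (unliftP ord0 b) => [a' ->|->] [b' ->|->];
    rewrite ?lift_perm_id ?lift_perm_lift ?lift0 //=; exact: H1.
- move=> a b; case: (unliftP ord0 a) (unliftP ord0 b) => [a' ->|->] [b' ->|->];
    rewrite ?lift_perm_id ?lift_perm_lift ?lift0 //=; exact: H2.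
- move=> a; case: (unliftP ord0 a) => [a' ->|->] //.
  by rewrite lift_perm_lift lift0 => /H3->.
Qed.

Lemma shuffle_lift_snd N (i : 'I_N.+1) n (s : 'S_N) :
  shuffle i n.+1 (lift_perm i ord0 s) = shuffle i n s.
Proof.
have liftE (a : 'I_N) : lift i a = ((i <= a) + a)%N :> nat by [].
apply/shuffleP/shuffleP => -[H1 H2 H3]; split.
- move=> a b Hab; have := H1 (lift i a) (lift i b).
  by rewrite !lift_perm_lift !lift0 !liftE; apply; lia.
- move=> a b Ha Hab Hb; have := H2 (lift i a) (lift i b).
  by rewrite !lift_perm_lift !lift0 !liftE; apply; lia.
- move=> a Ha; have := H3 (lift i a); rewrite liftE lift_perm_lift.
  have E : (i + n.+1 <= (i <= a) + a)%N by lia.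
  move=> /(_ E)/(congr1 val); rewrite /= /bump => E'; apply: val_inj => /=.
  by lia.
- move=> a b; case: (unliftP i a) (unliftP i b) => [a' ->|->] [b' ->|->];
    rewrite ?lift_perm_id ?lift_perm_lift ?lift0 //= /bump => Hab; try lia.
  by apply: H1; lia.
- move=> a b; case: (unliftP i a) (unliftP i b) => [a' ->|->] [b' ->|->];
    rewrite ?lift_perm_id ?lift_perm_lift ?lift0 //= /bump => Ha Hab Hb;
    try lia.
  by apply: H2; lia.
- move=> a; case: (unliftP i a) => [a' ->|->]; rewrite ?lift_perm_lift /=;
    last by lia.
  rewrite /bump; case: (leqP i a') => [le_ia|lt_ai] Ha; last first.
    by have := leq_ltn_trans Ha lt_ai; rewrite ltnNge leq_addr.
  have le_a : (i + n <= a')%N by rewrite addnS add1n ltnS in Ha.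
  by apply: val_inj; rewrite (H3 a' le_a) /= /bump le_ia.
Qed.

End Shuffles.

(** * The total composition as a sum over shuffles *)

Section ShuffleSums.
Variables (k : fieldType) (V : lmodType k).
Implicit Types (F G : seq V -> V).

Definition args N (x : 'I_N -> V) : seq V := [seq x j | j <- enum 'I_N].

Lemma size_args N (x : 'I_N -> V) : size (args x) = N.
Proof. by rewrite size_map size_enum_ord. Qed.

Lemma nth_args N (x : 'I_N -> V) (j : 'I_N) : nth 0 (args x) j = x j.
Proof. by rewrite (nth_map j) ?size_enum_ord // nth_ord_enum. Qed.

Lemma args_nth N (s : seq V) :
  size s = N -> args (fun j : 'I_N => nth 0 s j) = s.
Proof.
move=> Es; apply: (@eq_from_nth _ 0); rewrite size_args // => j lt_jN.
by rewrite (nth_args _ (Ordinal lt_jN)).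
Qed.

Lemma args_lift_perm N (x : 'I_N.+1 -> V) (j : 'I_N.+1) (s : 'S_N) :
  let t := args (x \o lift ord0 \o s) in
  args (x \o lift_perm j ord0 s) = take j t ++ x ord0 :: drop j t.
Proof.
move=> t; have St : size t = N by apply: size_args.
have le_jN : (j <= N)%N by rewrite -ltnS.
apply: (@eq_from_nth _ 0).
  by rewrite size_cat /= size_drop size_takel ?St // size_args addnS subnKC.
rewrite size_args => l lt_l.
have [{lt_l} o ->] : exists o : 'I_N.+1, l = o by exists (Ordinal lt_l).
rewrite nth_args /= nth_cat size_takel ?St //.
case: (unliftP j o) => [l' ->|->]; last by rewrite lift_perm_id ltnn subnn.
rewrite lift_perm_lift; have := nth_args (x \o lift ord0 \o s) l'.
rewrite -/t /= => <-; rewrite /bump; case: (leqP j l') => [le_jl|lt_lj].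
  by rewrite add1n ltnNge (leqW le_jl) subSn //= nth_drop subnKC.
by rewrite add0n lt_lj nth_take.
Qed.

Lemma args_recl N (x : 'I_N.+1 -> V) : args x = x ord0 :: args (x \o lift ord0).
Proof.
by rewrite /args enum_ordSl /= -map_comp.
Qed.

(** Deleting the point j and its value 0 from a permutation inverts
    [lift_perm j ord0]. *)
Lemma perm_sum_lift N (P : pred 'S_N.+1) (j : 'I_N.+1) (E : 'S_N.+1 -> V) :
  \sum_(s | P s && (s j == ord0)) E s =
  \sum_(s : 'S_N | P (lift_perm j ord0 s)) E (lift_perm j ord0 s).
Proof.
rewrite (reindex (lift_perm j ord0)) /=.
  by apply: eq_bigl => s; rewrite lift_perm_id eqxx andbT.
pose unl i (s : 'S_N.+1) l := odflt l (unlift (s i) (s (lift i l))).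
have unlK i (s : 'S_N.+1) l : lift (s i) (unl i s l) = s (lift i l).
  rewrite /unl; have := neq_lift i l.
  by rewrite -(can_eq (permK s)) => /unlift_some[] ? ? ->.
have inj_unl s : injective (unl j s).
  apply: can_inj (unl (s j) s^-1%g) _ => l.
  by rewrite {1}/unl unlK !permK liftK.
exists (fun s => perm (@inj_unl s)) => [s _|s /andP[_ /eqP sj0]].
  by apply/permP => l; rewrite permE /unl lift_perm_lift lift_perm_id liftK.
apply/permP => l; case: (unliftP j l) => [l'|] ->; rewrite ?lift_perm_id //.
by rewrite lift_perm_lift -sj0 permE unlK.
Qed.

Definition shuffle_sum N i n F (x : 'I_N -> V) : V :=
  \sum_(s : 'S_N | shuffle i n s) (-1) ^+ s *: F (args (x \o s)).

Lemma shuffle_sum00 N F (x : 'I_N -> V) : shuffle_sum 0 0 F x = F (args x).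
Proof.
rewrite /shuffle_sum (eq_bigl (pred1 1%g)) => [|s]; last exact: shuffle00.
rewrite big_pred1_eq odd_perm1 scale1r; congr (F (args _)).
by apply: funext => a; rewrite /= perm1.
Qed.

Lemma shuffle_sum_piece N i n F (x : 'I_N.+1 -> V) (j : 'I_N.+1) i' n' :
  (forall s, shuffle i n (lift_perm j ord0 s) = shuffle i' n' s) ->
  \sum_(s : 'S_N.+1 | shuffle i n s && (s j == ord0))
     (-1) ^+ s *: F (args (x \o s)) =
  (-1) ^+ j *: shuffle_sum i' n'
    (fun t => F (take j t ++ x ord0 :: drop j t)) (x \o lift ord0).
Proof.
move=> Es; rewrite perm_sum_lift /shuffle_sum scaler_sumr.
apply: eq_big => // s _; rewrite args_lift_perm scalerA; congr (_ *: _).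
by rewrite odd_lift_perm /= addbF signr_addb signr_odd.
Qed.

Lemma shuffle_sum_inj N (P : pred 'S_N.+1) j (E : 'S_N.+1 -> V) :
  (forall s, P s -> (s^-1)%g ord0 = j) ->
  \sum_(s | P s) E s = \sum_(s | P s && (s j == ord0)) E s.
Proof.
move=> HP; apply: eq_bigl => s; case: (boolP (P s)) => //= Ps.
by rewrite -(HP s Ps) permKV eqxx.
Qed.

(** When both blocks are nonempty the first argument opens either of them, which
    gives the two terms of [shuffle_sumSS]; it has to cross the i + 1 arguments
    of the first block to open the second. The other cases are degenerate. *)
Lemma shuffle_sumS0 N i F (x : 'I_N.+1 -> V) :
  shuffle_sum i.+1 0 F x =
  shuffle_sum i 0 (fix1 F (x ord0)) (x \o lift ord0).
Proof.
rewrite {1}/shuffle_sum (@shuffle_sum_inj _ _ ord0) => [|s Hs].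
  rewrite (@shuffle_sum_piece _ _ _ _ _ _ i 0); last exact: shuffle_lift_fst.
  by rewrite scale1r; under eq_fun do rewrite take0 drop0.
by case: (shuffle_min Hs isT (permKV s ord0)) => -[Ej] // _; apply: val_inj.
Qed.

Lemma shuffle_sum0S N n F (x : 'I_N.+1 -> V) :
  shuffle_sum 0 n.+1 F x =
  shuffle_sum 0 n (fix1 F (x ord0)) (x \o lift ord0).
Proof.
rewrite {1}/shuffle_sum (@shuffle_sum_inj _ _ ord0) => [|s Hs].
  rewrite (@shuffle_sum_piece _ _ _ _ _ _ 0 n) => [|s];
    last exact: (shuffle_lift_snd ord0).
  by rewrite scale1r; under eq_fun do rewrite take0 drop0.
by case: (shuffle_min Hs isT (permKV s ord0)) => -[Ej] // _; apply: val_inj.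
Qed.

Lemma shuffle_sumSS N i n F (x : 'I_N.+1 -> V) : (i < N)%N ->
  shuffle_sum i.+1 n.+1 F x =
  shuffle_sum i n.+1 (fix1 F (x ord0)) (x \o lift ord0) +
  (-1) ^+ i.+1 *: shuffle_sum i.+1 n
    (fun t => F (take i.+1 t ++ x ord0 :: drop i.+1 t)) (x \o lift ord0).
Proof.
move=> lt_iN; pose j : 'I_N.+1 := Ordinal (lt_iN : (i.+1 < N.+1)%N).
rewrite {1}/shuffle_sum (bigID (fun s : 'S_N.+1 => s ord0 == ord0)) /=.
congr (_ + _).
  rewrite (@shuffle_sum_piece _ _ _ _ _ _ i n.+1); last exact: shuffle_lift_fst.
  by rewrite scale1r; under eq_fun do rewrite take0 drop0.
rewrite (eq_bigl (fun s => shuffle i.+1 n.+1 s && (s j == ord0))) => [|s].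
  exact: (@shuffle_sum_piece _ _ _ _ _ j _ _ (@shuffle_lift_snd _ j n)).
apply: andb_id2l => Hs; apply/idP/eqP => [ns0|sj0].
  case: (shuffle_min Hs isT (permKV s ord0)) => -[Ej _].
    case/eqP: ns0; rewrite -[RHS](permKV s); congr (s _); exact: val_inj.
  by rewrite -[RHS](permKV s); congr (s _); apply: val_inj.
by apply/eqP => s0; have := perm_inj (etrans sj0 (esym s0)).
Qed.

Definition insert i a F G : seq V -> V := fun s =>
  F (take i s ++ G (take a (drop i s)) :: drop (i + a) s).

(** Both sides obey the same recursion on the first argument: the permutations
    for which it opens the first block make up the term with F partially
    evaluated, the others the term with G partially evaluated. *)
Lemma plug_shuffle_sum N n F G (x : 'I_N -> V) :
  plug n.+1 F G (args x) =
  \sum_(i < N - n) (-1) ^+ (i * n) *: shuffle_sum i n (insert i n.+1 F G) x.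
Proof.
elim: N n F G x => [|N IHN] n F G x.
  by rewrite sub0n big_ord0 (size0nil (size_args x)).
rewrite args_recl /= IHN; set x0 := x ord0; set x' := x \o lift ord0.
have fixS i a : fix1 (insert i.+1 a F G) x0 = insert i a (fix1 F x0) G by [].
case: n => [|n].
  rewrite !subn0 big_ord_recl plug0 expr0 !scale1r shuffle_sum00 addrC.
  congr (_ + _).
    by rewrite args_recl /insert /= drop0 take0.
  apply: eq_bigr => i _.
  by rewrite /= !muln0 !expr0 !scale1r shuffle_sumS0 fixS.
rewrite IHN subSS subnS; case EM: (N - n)%N => [|M] /=.
  by rewrite !big_ord0 scaler0 addr0.
rewrite !big_ord_recl /= !mul0n !expr0 !scale1r shuffle_sum0S.
rewrite addrCA; congr (_ + _).
  rewrite /insert /fix1 /=; congr (shuffle_sum _ _ _ _).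
  by apply: funext => t; rewrite !take0 !drop0.
rewrite scaler_sumr -big_split /=; apply: eq_bigr => i _.
have lt_iN : (i < N)%N by have := ltn_ord i; lia.
rewrite shuffle_sumSS // fixS scalerDr !scalerA -!exprD.
congr (_ *: _ + _ *: _).
  by rewrite /bump /= add1n mulnS !exprD mulrAC sqr_sign1 mul1r.
rewrite /shuffle_sum; apply: eq_bigr => s _; congr (_ *: _).
set t := args _; have St : size t = N by apply: size_args.
rewrite /insert /fix1 /bump /= add1n.
have S1 : size (take i.+1 t) = i.+1 by rewrite size_takel ?St.
rewrite take_size_cat // drop_size_cat //= drop_cat S1.
by rewrite ltnNge leq_addr addKn /= drop_drop addnC.
Qed.

End ShuffleSums.

(** * Multilinear maps as functions on lists *)

Section Listing.
Variables (k : fieldType) (V : lmodType k).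

(** The composition evaluates f on lists of the expected length only. *)
Lemma plug_eq0 a (f g : seq V -> V) s :
  (forall t, (size t + a)%N = (size s).+1 -> f t = 0) -> plug a f g s = 0.
Proof.
elim: s a f g => [|x s IHs] [|a] f g Hf //=; try by apply: Hf; rewrite addn0.
rewrite !IHs ?scaler0 ?addr0 // => t Et; apply: Hf; first by rewrite addnS Et.
by rewrite /= addSn Et.
Qed.

Section FixedArity.
Variable n : nat.
Implicit Types f g : mhom n V V.

Lemma to_list_subproof (f : mhom n V V) :
  list_multilinear (fun s =>
    if size s == n then f (fun j : 'I_n => nth 0 s j) else 0).
Proof.
move=> s1 s2 c u v; rewrite !size_cat /=.
case: eqP => [En|_]; last by rewrite scaler0 addr0.
have Hi : (size s1 < n)%N by rewrite -En addnS ltnS leq_addr.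
have E w : (fun j : 'I_n => nth 0 (s1 ++ w :: s2) j) =
    [eta (fun j : 'I_n => nth 0 (s1 ++ 0 :: s2) j) with Ordinal Hi |-> w].
  apply: funext => j /=; rewrite -val_eqE /= !nth_cat.
  case: ltngtP => // [lt_j|->]; last by rewrite subnn.
  by rewrite -(subnSK lt_j).
by rewrite (E (c *: u + v)) (E u) (E v) mhomP.
Qed.

(** Lists of the wrong length are sent to 0, which is compatible with [plug] by
    [plug_eq0] and makes the correspondence injective. *)
Definition to_list (f : mhom n V V) : cochain V :=
  mk_cochain (to_list_subproof f).

Lemma to_listE f s : to_list f s =
  if size s == n then f (fun j : 'I_n => nth 0 s j) else 0.
Proof. by []. Qed.

Lemma to_list_args f x : to_list f (args x) = f x.
Proof.
rewrite to_listE size_args eqxx; congr (mhom_fun f _); apply: funext => j.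
exact: nth_args.
Qed.

Lemma to_list_size f s : size s != n -> to_list f s = 0.
Proof. by rewrite to_listE => /negPf->. Qed.

Lemma to_list_ext f (c : cochain V) :
  (forall s, size s != n -> c s = 0) -> (forall x, f x = c (args x)) ->
  to_list f = c.
Proof.
move=> Hc Efc; apply: cochain_ext => s; rewrite to_listE.
by case: eqP => [Es|/eqP/Hc//]; rewrite Efc args_nth.
Qed.

Lemma to_list_inj : injective to_list.
Proof.
by move=> f g E; apply: mhom_ext => x; rewrite -!to_list_args E.
Qed.

Lemma to_list_linear : linear to_list.
Proof.
move=> c f g; apply: to_list_ext => [s ns|x].
  rewrite -[LHS]/(c *: to_list f s + to_list g s).
  by rewrite !to_list_size ?scaler0 ?addr0.
by rewrite -[RHS]/(c *: to_list f (args x) + to_list g (args x)) !to_list_args.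
Qed.

HB.instance Definition _ :=
  GRing.isLinear.Build k (mhom n V V) (cochain V) *:%R to_list to_list_linear.

End FixedArity.

Lemma to_list_cast m n (e : m = n) (f : mhom m.+1 V V) :
  to_list (deg_cast (fun r => mhom r.+1 V V) e f) = to_list f.
Proof. by case: n / e. Qed.

Lemma to_list_insertion m n (f : mhom m.+1 V V) (g : mhom n.+1 V V)
    (i : 'I_m.+1) (y : 'I_(m + n).+1 -> V) :
  insertion f g i y = insert i n.+1 (to_list f) (to_list g) (args y).
Proof.
have le_im : (i <= m)%N by rewrite -ltnS.
rewrite /insertion -to_list_args /insert; congr (to_list f _).
have Sy := size_args y.
have St : size (take i (args y)) = i by rewrite size_takel // Sy; lia.
apply: (@eq_from_nth _ 0).
  by rewrite size_args size_cat St /= size_drop Sy; lia.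
rewrite size_args => l lt_l.
have [{lt_l} j ->] : exists j : 'I_m.+1, l = j by exists (Ordinal lt_l).
have ltj := ltn_ord j.
have yE q : (q < (m + n).+1)%N -> y (inord q) = nth 0 (args y) q.
  by move=> ltq; rewrite -{2}(inordK ltq) nth_args.
rewrite nth_args nth_cat St; case: ltnP => [lt_ji|le_ij].
  by rewrite nth_take // yE //; lia.
case: eqP => [->|ne_ji].
  rewrite subnn /= -to_list_args; congr (to_list g _).
  apply: (@eq_from_nth _ 0).
    by rewrite size_args size_takel // size_drop Sy; lia.
  rewrite size_args => q ltq.
  have [{ltq} r ->] : exists r : 'I_n.+1, q = r by exists (Ordinal ltq).
  have ltr := ltn_ord r.
  by rewrite nth_args nth_take // nth_drop yE //; lia.
have lt_ij : (i < j)%N.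
  by rewrite ltn_neqAle le_ij andbT; apply/eqP => E; apply/ne_ji/val_inj.
rewrite -(subnSK lt_ij) /= nth_drop yE; last by lia.
by congr (nth _ _ _); lia.
Qed.

Lemma to_list_circ_sum m n (f : mhom m.+1 V V) (g : mhom n.+1 V V) :
  to_list (\sum_(i < m.+1) (-1) ^+ (i * n) *: circ f g i) =
  pre n (to_list f) (to_list g).
Proof.
apply: to_list_ext => [s ns|x].
  apply: plug_eq0 => t Et; apply: to_list_size.
  by apply: contra ns => /eqP Em; apply/eqP; rewrite Em in Et; lia.
rewrite [RHS]plug_shuffle_sum (_ : (m + n).+1 - n = m.+1)%N; last by lia.
rewrite (big_morph (fun f : mhom _ V V => f x) (id1 := 0) (op1 := +%R)) //.
apply: eq_bigr => i _; congr (_ *: _).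
by apply: eq_bigr => s _; rewrite to_list_insertion.
Qed.

Lemma to_list_balavoine m n (f : mhom m.+1 V V) (g : mhom n.+1 V V) :
  to_list (balavoine f g) = lie m n (to_list f) (to_list g).
Proof.
by rewrite linearB /= linearZ /= to_list_cast !to_list_circ_sum.
Qed.

End Listing.

(** * Weights and the stability of Hom(h^n, g) *)

Section Weights.
Variables (k : fieldType) (g h : lmodType k).
Notation V := (g * h)%type.
Implicit Types (f : seq V -> V) (t : seq (g + h)) (w : int).

Lemma list_multilinear0 f s1 s2 : list_multilinear f -> f (s1 ++ 0 :: s2) = 0.
Proof.
move=> Hf; have /eqP := Hf s1 s2 1 0 0.
by rewrite !scale1r addr0 -subr_eq0 opprD addNKr oppr_eq0 => /eqP.
Qed.

Definition in_sum (z : g + h) : V :=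
  match z with inl a => (a, 0) | inr u => (0, u) end.

Definition is_g (z : g + h) : bool := if z is inl _ then true else false.

(** The weight of a homogeneous operation is the number of its arguments in g
    minus the number (0 or 1) of its values in g. Only arguments that lie in g
    or in h are tested; by multilinearity they determine the operation
    ([pure_eq0]). *)
Definition has_weight w f : Prop := forall t,
  ((count is_g t)%:Z != w + 1 -> (f (map in_sum t)).1 = 0) /\
  ((count is_g t)%:Z != w -> (f (map in_sum t)).2 = 0).

Lemma in_sum_split (x : V) : x = in_sum (inl x.1) + in_sum (inr x.2).
Proof. by apply: injective_projections; rewrite /= ?addr0 ?add0r. Qed.

Lemma list_multilinear_split f x s : list_multilinear f ->
  f (x :: s) = f (in_sum (inl x.1) :: s) + f (in_sum (inr x.2) :: s).
Proof.
move=> Hf; rewrite {1}[x]in_sum_split -[in_sum (inl _)]scale1r (Hf [::]).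
by rewrite !scale1r.
Qed.

Lemma fix1_weight w f z :
  has_weight w f -> has_weight (w - (is_g z)%:Z) (fix1 f (in_sum z)).
Proof.
move=> Hf t; have [/= H1 H2] := Hf (z :: t).
by split=> Ht; [apply: H1 | apply: H2]; apply: contra Ht => /eqP E;
  apply/eqP; lia.
Qed.

Lemma weight_linear w (a : k) (f f' : cochain V) :
  has_weight w f -> has_weight w f' -> has_weight w (a *: f + f').
Proof.
move=> Hf Hf' t; have [H1 H2] := Hf t; have [H1' H2'] := Hf' t.
by split=> Ht; rewrite /= ?H1 ?H1' ?H2 ?H2' // scaler0 addr0.
Qed.

(** A vector of weight w' has a component in g only if w' = -1 and one in h only
    if w' = 0; as an argument of f it counts once in the former case. *)
Lemma plug_value_weight w w' f f' : list_multilinear f ->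
  has_weight w f -> has_weight w' f' -> has_weight (w + w') (plug 0 f f').
Proof.
move=> Hf Hw Hw' t; rewrite plug0 /fix1 list_multilinear_split //.
set y := f' [::]; have [/= C1 C2] := Hw' [::]; rewrite -/y in C1 C2.
have [/= A1 A2] := Hw (inl y.1 :: t); have [/= B1 B2] := Hw (inr y.2 :: t).
have Z1 : y.1 = 0 -> f ((y.1, 0) :: map in_sum t) = 0.
  by move->; apply: (list_multilinear0 [::]).
have Z2 : y.2 = 0 -> f ((0, y.2) :: map in_sum t) = 0.
  by move->; apply: (list_multilinear0 [::]).
have [Ey1|Ey1] := eqVneq (0%:Z) (w' + 1); have [Ey2|Ey2] := eqVneq (0%:Z) w';
  split=> Ht /=.
all: try by lia.
all: rewrite ?(Z1 (C1 Ey1)) ?(Z2 (C2 Ey2)) /= ?A1 ?A2 ?B1 ?B2 ?addr0 //; lia.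
Qed.

Lemma plug_weight a w w' f f' : list_multilinear f ->
  has_weight w f -> has_weight w' f' -> has_weight (w + w') (plug a f f').
Proof.
move=> Hf Hw Hw' t.
elim: t a w w' f f' Hf Hw Hw' => [|z t IHt] [|a] w w' f f' Hf Hw Hw' //;
  try exact: plug_value_weight.
have Hz := fix1_multilinear (in_sum z) Hf.
have [P1 P2] := IHt a.+1 _ _ _ _ Hz (fix1_weight z Hw) Hw'.
have [Q1 Q2] := IHt a _ _ _ _ Hf Hw (fix1_weight z Hw').
by split=> /= Ht; rewrite ?P1 ?P2 ?Q1 ?Q2 ?scaler0 ?addr0 //;
  apply: contra Ht => /eqP E; apply/eqP; lia.
Qed.

Lemma pure_eq0 f : list_multilinear f -> (forall t, f (map in_sum t) = 0) ->
  forall s, f s = 0.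
Proof.
move=> Hf H0 s; elim: s f Hf H0 => [|x s IHs] f Hf H0; first exact: (H0 [::]).
rewrite list_multilinear_split //.
rewrite -[X in X + _]/(fix1 f _ s) -[X in _ + X]/(fix1 f _ s).
rewrite !IHs ?addr0 //; try exact: fix1_multilinear.
  by move=> t; apply: (H0 (_ :: t)).
by move=> t; apply: (H0 (_ :: t)).
Qed.

(** A number of arguments minus 0 or 1 is at least -1. *)
Lemma weightN2_eq0 (c : cochain V) : has_weight (- 2) c -> c = 0.
Proof.
move=> Hc; apply: cochain_ext; apply: pure_eq0 (cochainP c) _ => t.
by have [H1 H2] := Hc t; apply: injective_projections; rewrite ?H1 ?H2 //; lia.
Qed.

Definition forget_g (x : V) : V := (0, x.2).

Lemma forget_g_eq0 f t : list_multilinear f -> has is_g t ->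
  f (map forget_g (map in_sum t)) = 0.
Proof.
move=> Hf; elim: t f Hf => [|[a|u] t IHt] f Hf //= Ht.
  exact: (list_multilinear0 [::]).
exact: (IHt (fix1 f (0, u)) (fix1_multilinear _ Hf)).
Qed.

Lemma forget_g_id t :
  ~~ has is_g t -> map forget_g (map in_sum t) = map in_sum t.
Proof. by elim: t => [|[a|u] t IHt] //= /IHt->. Qed.

Lemma weightN1_intro f : list_multilinear f -> (forall s, (f s).2 = 0) ->
  (forall s, f s = f (map forget_g s)) -> has_weight (- 1) f.
Proof.
move=> Hf f2 fE t; split=> // Ht; rewrite fE forget_g_eq0 //.
by rewrite has_count; lia.
Qed.

Lemma to_list_embed n (P : mhom n h g) s :
  to_list (embed P) s = to_list (embed P) (map forget_g s).
Proof.
rewrite !to_listE size_map; case: eqP => // En; congr (mhom_fun P _, 0).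
by apply: funext => j; rewrite (nth_map 0) ?En.
Qed.

Lemma embed_weight n (P : mhom n h g) : has_weight (- 1) (to_list (embed P)).
Proof.
apply: weightN1_intro => [|s|s]; first exact: cochainP.
  by rewrite to_listE; case: eqP.
exact: to_list_embed.
Qed.

Lemma to_list_unembed n (F : mhom n V V) s :
  to_list (embed (unembed F)) s = ((to_list F (map forget_g s)).1, 0).
Proof.
rewrite !to_listE size_map; case: eqP => // En.
have -> : (fun j : 'I_n => nth 0 (map forget_g s) j) =
    (fun j : 'I_n => forget_g (nth 0 s j)).
  by apply: funext => j; rewrite (nth_map 0) ?En.
by [].
Qed.

(** Weight -1 means no argument in g and a value in g, so that such an operation
    only depends on the h-components of its arguments. *)
Lemma embed_of_weight n (F : mhom n V V) :
  has_weight (- 1) (to_list F) -> embed (unembed F) = F.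
Proof.
move=> HF; apply: to_list_inj; apply/eqP; rewrite -subr_eq0; apply/eqP.
apply: cochain_ext; apply: pure_eq0 => [|t]; first exact: cochainP.
set s := map _ _; apply/eqP.
have -> : (to_list (embed (unembed F)) - to_list F) s =
  to_list (embed (unembed F)) s - to_list F s by [].
rewrite subr_eq0 to_list_unembed; apply/eqP; have [H1 H2] := HF t.
have [Ht|Ht] := boolP (has is_g t).
  rewrite forget_g_eq0 ?Ht //; last exact: cochainP.
  rewrite has_count in Ht.
  by apply: injective_projections; rewrite /= ?H1 ?H2 //; lia.
by rewrite forget_g_id //; apply: injective_projections; rewrite //= H2.
Qed.

Lemma lie_weight m n w w' (c c' : cochain V) :
  has_weight w c -> has_weight w' c' -> has_weight (w + w') (lie m n c c').
Proof.
move=> Hc Hc'; rewrite /lie -scaleNr [pre n c c' + _]addrC.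
apply: weight_linear.
  by rewrite addrC; apply: plug_weight (cochainP _) _ _.
exact: plug_weight (cochainP _) _ _.
Qed.

Variables (brg : {bilinear g -> g -> g}) (brh : {bilinear h -> h -> h}).
Variables (rhoL : {bilinear g -> h -> h}) (rhoR : {bilinear h -> g -> h}).
Variable lam : k.

Lemma to_list_theta x y :
  to_list (theta brg rhoL rhoR) [:: x; y] = theta_fun brg rhoL rhoR x y.
Proof. by []. Qed.

Lemma to_list_theta' x y :
  to_list (theta' g brh lam) [:: x; y] = theta'_fun brh lam x y.
Proof. by []. Qed.

Lemma theta_weight : has_weight 1 (to_list (theta brg rhoL rhoR)).
Proof.
move=> [|z1 [|z2 [|z3 t]]] //; rewrite [map _ _]/= to_list_theta.
by case: z1 z2 => [a1|u1] [a2|u2]; split=> //= _;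
  rewrite ?linear0l ?linear0r ?addr0.
Qed.

Lemma theta'_weight : has_weight 0 (to_list (theta' g brh lam)).
Proof.
move=> [|z1 [|z2 [|z3 t]]] //; rewrite [map _ _]/= to_list_theta'.
by case: z1 z2 => [a1|u1] [a2|u2]; split=> //= _;
  rewrite ?linear0l ?linear0r ?scaler0 ?oppr0.
Qed.

End Weights.

(** * The structure equations *)

Section LowArity.
Variables (k : fieldType) (V : lmodType k).

(** With f = f', the obstruction to the left Leibniz identity. *)
Lemma pre1_args3 (f f' : cochain V) a b c :
  pre 1 f f' [:: a; b; c] =
  f [:: f' [:: a; b]; c] - f [:: a; f' [:: b; c]] + f [:: b; f' [:: a; c]].
Proof.
rewrite /= /fix1.
rewrite !(expr0, expr1, scaler0, add0r, scale1r, scaleN1r, addr0, oppr0).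
by rewrite [f [:: b; _] + _]addrC addrCA addrA.
Qed.

Lemma lie10_args2 (f f' : cochain V) a b :
  lie 1 0 f f' [:: a; b] =
  f [:: f' [:: a]; b] + f [:: a; f' [:: b]] - f' [:: f [:: a; b]].
Proof.
have -> : lie 1 0 f f' [:: a; b] =
    pre 0 f f' [:: a; b] - 1 *: pre 1 f' f [:: a; b] by [].
rewrite /= /fix1.
rewrite !(expr0, expr1, scaler0, add0r, scale1r, scaleN1r, addr0, oppr0).
by rewrite [f [:: a; _] + _]addrC.
Qed.

Lemma lie11_eq0 (F G : mhom 2 V V) :
  (forall a b c, pre 1 (to_list F) (to_list G) [:: a; b; c] +
                 pre 1 (to_list G) (to_list F) [:: a; b; c] = 0) ->
  lie 1 1 (to_list F) (to_list G) = 0.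
Proof.
move=> H; rewrite -(@to_list_balavoine _ _ 1 1); apply: cochain_ext.
move=> [|a [|b [|c [|d s]]]] //; rewrite to_list_balavoine.
have -> : lie 1 1 (to_list F) (to_list G) [:: a; b; c] =
    pre 1 (to_list F) (to_list G) [:: a; b; c] -
    (-1) *: pre 1 (to_list G) (to_list F) [:: a; b; c] by [].
by rewrite scaleN1r opprK H.
Qed.

End LowArity.

Section StructureEquations.
Variables (k : fieldType) (g h : lmodType k) (lam : k).
Variables (brg : {bilinear g -> g -> g}) (brh : {bilinear h -> h -> h}).
Variables (rhoL : {bilinear g -> h -> h}) (rhoR : {bilinear h -> g -> h}).

Notation th := (to_list (theta brg rhoL rhoR)).
Notation th' := (to_list (theta' g brh lam)).

Lemma lie_theta_theta : leibniz_algebra brg ->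
  leibniz_representation brg rhoL rhoR -> lie 1 1 th th = 0.
Proof.
move=> Hg [LL LR RR]; apply: lie11_eq0 => a b c.
suff -> : pre 1 th th [:: a; b; c] = 0 by rewrite addr0.
rewrite pre1_args3 !to_list_theta /theta_fun.
apply: injective_projections => /=.
  rewrite Hg; lin_coefs k g; ring.
(* each of the three axioms of a representation occurs once, according to the
   only argument lying in h *)
rewrite !linearDr !linearDl /= LL (LR a.1 c.1 b.2) (RR b.1 c.1 a.2).
lin_coefs k h; ring.
Qed.

Lemma lie_theta'_theta' : leibniz_algebra brh -> lie 1 1 th' th' = 0.
Proof.
move=> Hh; apply: lie11_eq0 => a b c.
suff -> : pre 1 th' th' [:: a; b; c] = 0 by rewrite addr0.
rewrite pre1_args3 !to_list_theta' /theta'_fun.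
apply: injective_projections => /=.
  by rewrite subr0 addr0.
rewrite !linearNr !linearNl /= !linearZr_LR !linearZl_LR /= Hh.
lin_coefs k h; ring.
Qed.

Lemma lie_theta'_theta : leibniz_alg_representation brg brh rhoL rhoR ->
  lie 1 1 th' th = 0.
Proof.
move=> [_ HR HRL HL]; apply: lie11_eq0 => a b c.
rewrite !pre1_args3 !to_list_theta' !to_list_theta /theta'_fun /theta_fun.
apply: injective_projections => /=.
  by rewrite !linear0l !linear0r !(subr0, addr0).
rewrite !linearDr !linearDl /= !linear0l !linear0r !linearNr !linearNl /=.
(* each of the three axioms occurs once, according to the only argument lying
   in g *)
rewrite !linearZr_LR !linearZl_LR /= HR (HRL a.2 c.2 b.1) (HL b.2 c.2 a.1).
lin_coefs k h; ring.
Qed.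

End StructureEquations.

(** * The derived bracket on Hom(h^n, g) *)

Section EmbeddedBracket.
Variables (k : fieldType) (g h : lmodType k) (lam : k).
Variables (brg : {bilinear g -> g -> g}) (brh : {bilinear h -> h -> h}).
Variables (rhoL : {bilinear g -> h -> h}) (rhoR : {bilinear h -> g -> h}).
Notation V := (g * h)%type.
Notation th := (to_list (theta brg rhoL rhoR)).
Notation th' := (to_list (theta' g brh lam)).

Definition lie_bil m n : {bilinear cochain V -> cochain V -> cochain V} :=
  lie m n.

Definition listed n (P : mhom n h g) : cochain V := to_list (embed P).

Lemma listed_inj n : injective (@listed n).
Proof. exact: inj_comp (@to_list_inj _ _ _) (can_inj (@embedK _ _ _ _)). Qed.

Lemma embed_linear n : linear (@embed k g h n).
Proof.
move=> c P Q; apply: mhom_ext => x; apply: injective_projections => //=.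
by rewrite scaler0 addr0.
Qed.

HB.instance Definition _ n := GRing.isLinear.Build k (mhom n h g) (mhom n V V)
  *:%R (@embed k g h n) (@embed_linear n).

Lemma listed_linear n : linear (@listed n).
Proof. by move=> c P Q; rewrite /listed linearP /= linearP. Qed.

HB.instance Definition _ n := GRing.isLinear.Build k (mhom n h g) (cochain V)
  *:%R (@listed n) (@listed_linear n).

Lemma listed_cast m n (e : m = n) (P : mhom_pos g h m) :
  @listed n.+1 (deg_cast (mhom_pos g h) e P) = @listed m.+1 P.
Proof. by case: n / e. Qed.

Lemma lie_listed m n a b (P : mhom a h g) (Q : mhom b h g) :
  lie m n (listed P) (listed Q) = 0.
Proof.
apply: weightN2_eq0; exact: lie_weight (embed_weight P) (embed_weight Q).
Qed.

Lemma to_list_derived_full m n (P : mhom m.+1 h g) (Q : mhom n.+1 h g) :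
  to_list (derived_full brg rhoL rhoR P Q) =
  derived lie_bil th m n (listed P) (listed Q).
Proof.
rewrite /derived_full linearZ /= (@to_list_balavoine _ _ m.+1 n).
by rewrite (@to_list_balavoine _ _ 1 m).
Qed.

Lemma to_list_diff_full n (P : mhom n.+1 h g) :
  to_list (diff_full brh lam P) = lie 1 n th' (listed P).
Proof. exact: (@to_list_balavoine _ _ 1 n). Qed.

Lemma embed_derived_bracket m n (P : mhom m.+1 h g) (Q : mhom n.+1 h g) :
  embed (derived_bracket brg rhoL rhoR P Q) = derived_full brg rhoL rhoR P Q.
Proof.
apply: embed_of_weight; rewrite to_list_derived_full /derived.
rewrite -[X in has_weight _ (cochain_fun X)]addr0; apply: weight_linear => //.
apply: (@lie_weight _ _ _ _ _ (1 + -1) (-1)) (embed_weight _).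
exact: lie_weight (theta_weight _ _ _) (embed_weight _).
Qed.

Lemma embed_derived_diff n (P : mhom n.+1 h g) :
  embed (derived_diff brh lam P) = diff_full brh lam P.
Proof.
apply: embed_of_weight; rewrite to_list_diff_full.
exact: lie_weight (theta'_weight _ _) (embed_weight _).
Qed.

Lemma listed_bracket m n (P : mhom m.+1 h g) (Q : mhom n.+1 h g) :
  listed (derived_bracket brg rhoL rhoR P Q) =
  derived lie_bil th m n (listed P) (listed Q).
Proof. by rewrite /listed embed_derived_bracket to_list_derived_full. Qed.

Lemma listed_diff n (P : mhom n.+1 h g) :
  listed (derived_diff brh lam P) = lie 1 n th' (listed P).
Proof. by rewrite /listed embed_derived_diff to_list_diff_full. Qed.

End EmbeddedBracket.

(** * Maurer-Cartan elements and the theorem *)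

Section MaurerCartan.
Variables (k : fieldType) (g h : lmodType k) (lam : k).
Variables (brg : {bilinear g -> g -> g}) (brh : {bilinear h -> h -> h}).
Variables (rhoL : {bilinear g -> h -> h}) (rhoR : {bilinear h -> g -> h}).

(** In [[theta, T], T] every term in which T is applied twice to one argument
    vanishes, since T kills g; the remaining terms occur in pairs. *)
Lemma maurer_cartan_value (T : {linear h -> g}) (x : 'I_2 -> h) :
  2 != 0 :> k ->
  (derived_diff brh lam (mhom1 T)
   + 2^-1 *: derived_bracket brg rhoL rhoR (mhom1 T) (mhom1 T)) x =
  T (rhoL (T (x ord0)) (x ord_max) + rhoR (x ord0) (T (x ord_max))
     + lam *: brh (x ord0) (x ord_max))
  - brg (T (x ord0)) (T (x ord_max)).
Proof.
move=> nz2; set u := x ord0; set v := x ord_max; set F := (_ + _).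
set t := listed (mhom1 T); set s := [:: (0, u); (0, v)] : seq (g * h).
have tE y : t [:: y] = (T y.2, 0) by [].
have -> : F x = (listed F s).1.
  rewrite /listed to_listE /=; congr (mhom_fun F _).
  by apply: funext => -[[|[|//]] Hi] /=; rewrite /u /v; congr x; apply: val_inj.
pose th := to_list (theta brg rhoL rhoR).
pose th' := to_list (theta' g brh lam).
have -> : listed F = lie 1 0 th' t - 2^-1 *: lie 1 0 (lie 1 0 th t) t.
  rewrite /F linearD linearZ /= listed_diff (@listed_bracket _ _ _ _ _ _ 0 0).
  by rewrite /derived -/t expr1 scaleN1r scalerN.
have -> : (lie 1 0 th' t - 2^-1 *: lie 1 0 (lie 1 0 th t) t) s =
  lie 1 0 th' t s - 2^-1 *: lie 1 0 (lie 1 0 th t) t s by [].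
rewrite /s !lie10_args2 !tE !to_list_theta !to_list_theta'.
rewrite /theta_fun /theta'_fun /=.
rewrite !(linear0l rhoL) !(linear0r rhoR) !(linear0l brg) !(linear0r brg).
rewrite !(addr0, add0r) subr0 !(linearD T) (linearN T) /=.
set w := T (lam *: _).
lin_coefs k g; field => //.
Qed.

End MaurerCartan.

Theorem theorem4p1 (k : fieldType) (char0 : [pchar k] =i pred0) (lam : k)
    (g h : lmodType k)
    (brg : {bilinear g -> g -> g}) (brh : {bilinear h -> h -> h})
    (rhoL : {bilinear g -> h -> h}) (rhoR : {bilinear h -> g -> h})
    (Hg : leibniz_algebra brg) (Hh : leibniz_algebra brh)
    (Hrep : leibniz_alg_representation brg brh rhoL rhoR) :
  [/\ (* the bracket and the differential take values in Hom(h^n, g) *)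
      forall (m n : nat) (P : mhom m.+1 h g) (Q : mhom n.+1 h g),
        embed (derived_bracket brg rhoL rhoR P Q) =
          derived_full brg rhoL rhoR P Q,
      forall (n : nat) (P : mhom n.+1 h g),
        embed (derived_diff brh lam P) = diff_full brh lam P,
      @is_dgla k (mhom_pos g h)
        (derived_bracket brg rhoL rhoR) (derived_diff brh lam)
    & forall T : {linear h -> g},
        relative_rota_baxter brg brh rhoL rhoR lam T <->
        @maurer_cartan k (mhom_pos g h)
          (derived_bracket brg rhoL rhoR) (derived_diff brh lam) (mhom1 T)].
Proof.
have nz2 : 2 != 0 :> k by have := char0 2%N; rewrite inE /= => ->.
have Htt := lie_theta_theta Hg (alg_rep_rep Hrep).
have Hdd := lie_theta'_theta' g lam Hh.
have Hdt := lie_theta'_theta lam Hrep.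
have skew m n (x y : cochain (g * h)%type) := lie_skew m n x y.
have jacobi m n p (x y z : cochain (g * h)%type) := lie_jacobi m n p x y z.
split.
- exact: embed_derived_bracket.
- exact: embed_derived_diff.
- split.
  + move=> m n; split=> [Q c P P'|P c Q Q']; apply: listed_inj;
      rewrite linearP /= !listed_bracket linearP /derived /=.
      rewrite linearPr /= linearPl /= scalerDr !scalerA mulrC //.
    by rewrite linearPr /= scalerDr !scalerA mulrC.
  + move=> n c P P'; apply: listed_inj.
    by rewrite linearP /= !listed_diff linearP linearPr.
  + move=> m n P Q; apply: listed_inj; rewrite linearN linearZ /= listed_cast.
    rewrite !listed_bracket; apply: derived_skew => //.
    exact: lie_listed.
  + move=> m n p P Q R; apply: listed_inj.
    rewrite linearD linearZ /= !listed_cast !listed_bracket.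
    exact: derived_jacobi.
  + move=> n P; apply: listed_inj; rewrite !listed_diff.
    rewrite linear0; apply: (@ad1_square0 _ _ (@lie_bil k g h)) => //.
  + move=> m n P Q; apply: listed_inj; rewrite linearD linearZ /= !listed_cast.
    rewrite !(listed_diff, listed_bracket).
    exact: (@derived_derivation _ _ (@lie_bil k g h)).
- move=> T; split=> [HT|HT u v].
    apply: mhom_ext => x; rewrite maurer_cartan_value // HT subrr //.
  have := maurer_cartan_value lam brg brh rhoL rhoR T
    (fun i : 'I_2 => if i == ord0 then u else v) nz2.
  rewrite /maurer_cartan in HT; rewrite HT /= => /eqP.
  by rewrite eq_sym subr_eq0 => /eqP.
Qed.
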